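(* There exist absolute constants $\kappa_1,\kappa_2>0$ such that for all $c_1\ge\kappa_1$, $c_2\ge\kappa_2$ and every $\rho>0$ there exists a constant $C>0$, depending only on $\rho,c_1,c_2$, with the following property. For all integers $n\ge 2$ and $r\ge 2$ and every mean matrix $s$ such that $s_i^{(j)}\le 1-\rho$ for all $i\in\{1,\dots,n\}$, $j\in\{1,\dots,r\}$, the estimator $\tilde s$ computed with the EI strategy (with constants $c_1,c_2$ in the penalty) satisfies $$\mathbb{E}_s\|s-\tilde s\|^2\le C\,\log n\,\inf_{m\in\mathcal{M}}\mathbb{E}_s\|s-\hat s_m\|^2 .$$
   Context: Model. $n\ge1$, $r\ge2$ are integers. $X_1,\dots,X_n$ are independent random column vectors, $X_i\in\{0,1\}^r$ with components summing to one. $X$ is the $r\times n$ random matrix with $i$th column $X_i$ and $s$ is its expectation (so each column of $s$ is a probability on $\{1,\dots,r\}$, and $s$ determines the law of $X$). $\mathbb{P}_s,\mathbb{E}_s$ denote probability and expectation when the mean of $X$ is $s$. For an $r\times n$ matrix $t$, $t^{(j)}$ is its $j$th line (a vector of $\mathbb{R}^n$), $t_i$ its $i$th column, $t_i^{(j)}$ its $(j,i)$ entry; $\langle t,t'\rangle=\sum_{i,j}t_i^{(j)}t_i'^{(j)}$ and $\|\cdot\|$ is the associated norm. For a linear subspace $S\subset\mathbb{R}^n$, $\mathbb{R}^r\otimes S$ is the set of $r\times n$ matrices all of whose lines belong to $S$. Penalized estimator. Given a finite collection $\{S_m,m\in\mathcal{M}\}$ of linear subspaces of $\mathbb{R}^n$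 with $D_m=\dim S_m$ and a penalty $\mathrm{pen}:\mathcal{M}\to\mathbb{R}_+$, $\hat s_m$ is the orthogonal projection of $X$ onto $\mathbb{R}^r\otimes S_m$, $\gamma_n(t)=\|t\|^2-2\langle X,t\rangle$, and $\tilde s=\hat s_{\hat m}$ where $\hat m$ minimizes $\gamma_n(\hat s_m)+\mathrm{pen}(m)$ over $m\in\mathcal{M}$. EI strategy. $\mathcal{M}$ is the collection of all partitions of $\{1,\dots,n\}$ into intervals; for $m\in\mathcal{M}$, $S_m$ is the linear span of the indicator vectors $\psi_I\in\mathbb{R}^n$, $I\in m$ ($i$th component of $\psi_I$ is $1$ if $i\in I$, $0$ otherwise), so $D_m=|m|$; and $\mathrm{pen}(m)=D_m\left(c_1\log\left(\frac{n}{D_m}\right)+c_2\right)$. *)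

(* Defs.v *)
From HB Require Import structures.
From mathcomp Require Import all_boot all_order all_algebra.
From mathcomp Require Import all_classical all_reals all_analysis.

Set Implicit Arguments.
Unset Strict Implicit.
Unset Printing Implicit Defensive.

Import Order.TTheory GRing.Theory Num.Theory.
Import numFieldNormedType.Exports.

Local Open Scope classical_set_scope.
Local Open Scope ring_scope.

(** Euclidean structure on r x n matrices. The library norm [`|t|] on matrices
    is the sup norm, hence the separate [frob_norm]. *)

Definition frob_inner (R : realType) (r n : nat) (t t' : 'M[R]_(r, n)) : R :=
  \sum_(i < n) \sum_(j < r) t j i * t' j i.

Definition frob_norm (R : realType) (r n : nat) (t : 'M[R]_(r, n)) : R :=
  Num.sqrt (frob_inner t t).

(** [tensor_lines r S] is R^r (x) S. *)
Definition tensor_lines (R : realType) (r n : nat) (S : {vspace 'rV[R]_n}) :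
    set 'M[R]_(r, n) :=
  [set t | forall j : 'I_r, row j t \in S].

Definition is_orth_proj (R : realType) (r n : nat) (V : set 'M[R]_(r, n))
    (x p : 'M[R]_(r, n)) : Prop :=
  V p /\ forall t, V t -> frob_inner (x - p) t = 0.

(** [get] is classical choice; on the spaces used here it is never applied to
    an empty set, see [s_hatP] below. *)
Definition orth_proj (R : realType) (r n : nat) (V : set 'M[R]_(r, n))
    (x : 'M[R]_(r, n)) : 'M[R]_(r, n) :=
  get [set p | is_orth_proj V x p].

Definition s_hat (R : realType) (r n : nat) (S : {vspace 'rV[R]_n})
    (x : 'M[R]_(r, n)) : 'M[R]_(r, n) :=
  orth_proj (@tensor_lines R r n S) x.

Definition gamma_n (R : realType) (r n : nat) (x t : 'M[R]_(r, n)) : R :=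
  frob_norm t ^+ 2 - 2 * frob_inner x t.

(** [m] is one of the (possibly several) minimizers over [M] of the penalized
    criterion computed from the observation [x]. *)
Definition penalized_minimizer (R : realType) (r n : nat) (I : finType)
    (M : {set I}) (S : I -> {vspace 'rV[R]_n}) (pen : I -> R)
    (x : 'M[R]_(r, n)) (m : I) : Prop :=
  m \in M /\
  forall m', m' \in M ->
    gamma_n x (s_hat (S m) x) + pen m <= gamma_n x (s_hat (S m') x) + pen m'.

(** Nonemptiness of intervals is enforced by [partition] in [EI_collection]. *)
Definition is_intervalb (n : nat) (I : {set 'I_n}) : bool :=
  [exists a : 'I_n, exists b : 'I_n, I == [set i : 'I_n | (a <= i <= b)%N]%SET].

Definition EI_collection (n : nat) : {set {set {set 'I_n}}} :=
  [set m : {set {set 'I_n}} |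
     finset.partition m [set: 'I_n]%SET && [forall J in m, is_intervalb J]]%SET.

Definition psi (R : realType) (n : nat) (I : {set 'I_n}) : 'rV[R]_n :=
  \row_(i < n) (i \in I)%:R.

Definition EI_space (R : realType) (n : nat) (m : {set {set 'I_n}}) :
    {vspace 'rV[R]_n} :=
  <<[seq psi R J | J <- enum m]>>%VS.

Definition EI_pen (R : realType) (n : nat) (c1 c2 : R) (m : {set {set 'I_n}}) : R :=
  let D : R := (\dim (EI_space R m))%:R in
  D * (c1 * ln (n%:R / D) + c2).

(** Mutual independence of random vectors in R^r, tested on Borel sets. *)
Definition independent_vectors (R : realType) (d : measure_display)
    (T : measurableType d) (P : probability T R) (r : nat) (I : finType)
    (Y : I -> T -> 'cV[R]_r) : Prop :=
  forall (J : {set I}) (B : I -> set 'cV[R]_r),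
    (forall i, i \in J -> <<s @open 'cV[R]_r >> (B i)) ->
    P (\bigcap_(i in [set` J]) (Y i @^-1` B i)) =
    (\prod_(i in J) P (Y i @^-1` B i))%E.

Definition obs_matrix (R : realType) (d : measure_display)
    (T : measurableType d) (P : probability T R) (r n : nat)
    (X : 'I_r -> 'I_n -> {RV P >-> R}) (w : T) : 'M[R]_(r, n) :=
  \matrix_(j < r, i < n) X j i w.

Definition is_model (R : realType) (d : measure_display)
    (T : measurableType d) (P : probability T R) (r n : nat)
    (X : 'I_r -> 'I_n -> {RV P >-> R}) (s : 'M[R]_(r, n)) : Prop :=
  [/\ forall j i w, X j i w = 0 \/ X j i w = 1,
      forall i w, \sum_(j < r) X j i w = 1,
      independent_vectors P (fun i w => col i (obs_matrix X w)) &
      forall j i, ('E_P[X j i] = (s j i)%:E)%E].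

Definition quadratic_risk (R : realType) (d : measure_display)
    (T : measurableType d) (P : probability T R) (r n : nat)
    (s : 'M[R]_(r, n)) (est : T -> 'M[R]_(r, n)) : \bar R :=
  ('E_P[(fun w => frob_norm (s - est w) ^+ 2)%R])%E.

Lemma row_proj_exists (R : realType) (n : nat) (S : {vspace 'rV[R]_n})
    (x : 'rV[R]_n) :
  exists2 p, p \in S & forall t, t \in S -> frob_inner (x - p) t = 0.
Proof.
have innerD (u v t : 'rV[R]_n) (a : R) :
    frob_inner (a *: u + v) t = a * frob_inner u t + frob_inner v t.
  rewrite /frob_inner mulr_sumr -big_split; apply: eq_bigr => i _ /=.
  rewrite mulr_sumr -big_split; apply: eq_bigr => j _ /=.
  by rewrite !mxE mulrDl mulrA.
have innerC (u v : 'rV[R]_n) : frob_inner u v = frob_inner v u.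
  by apply: eq_bigr => i _; apply: eq_bigr => j _; rewrite mulrC.
have inner0 (u : 'rV[R]_n) : frob_inner u u = 0 -> u = 0.
  move=> u0; apply/rowP => i; rewrite mxE.
  have ge0 (k : 'I_n) : true -> 0 <= \sum_(j < 1) u j k * u j k.
    by move=> _; apply: sumr_ge0 => j _; rewrite -expr2 sqr_ge0.
  move/(psumr_eq0P ge0): u0 => /(_ i isT); rewrite big_ord1 => /eqP.
  by rewrite mulf_eq0 orbb => /eqP.
rewrite -(span_basis (vbasisP S)); move: (val (vbasis S)) => e.
elim: e x => [|v e IH] x.
  exists 0; first exact: mem0v.
  move=> t; rewrite span_nil memv0 => /eqP ->.
  by apply: big1 => i _; apply: big1 => j _; rewrite !mxE mulr0.
have [p pS px] := IH x; have [q qS qv] := IH v.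
set v' := v - q in qv.
have [v'0|v'0] := eqVneq v' 0.
  have vS : v \in <<e>>%VS by move/eqP: v'0; rewrite subr_eq0 => /eqP ->.
  suff -> : <<v :: e>>%VS = <<e>>%VS by exists p.
  by rewrite span_cons; apply/addv_idPr; rewrite -memvE.
have nz : frob_inner v' v' != 0 by apply: contra_neq v'0; exact: inner0.
have sub y : y \in <<e>>%VS -> y \in <<v :: e>>%VS.
  by rewrite span_cons => yS; exact: (subvP (addvSr _ _)).
have vin : v \in <<v :: e>>%VS by rewrite memv_span // mem_head.
pose c := frob_inner (x - p) v' / frob_inner v' v'.
exists (p + c *: v').
  apply: memvD; first exact: sub.
  by apply: memvZ; apply: memvB => //; exact: sub.
have E : x - (p + c *: v') = (- c) *: v' + (x - p).
  by rewrite opprD addrA addrC scaleNr.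
move=> t; rewrite span_cons E => /memv_addP [_ /vlineP[k ->] [t' t'S ->]].
rewrite innerC.
have -> : k *: v + t' = k *: v' + (k *: q + t').
  by rewrite /v' scalerBr addrA subrK.
have wS : k *: q + t' \in <<e>>%VS by rewrite memvD // memvZ.
rewrite innerD !(innerC _ ((- c) *: v' + (x - p))) !innerD.
by rewrite (qv _ wS) (px _ wS) mulNr divfK // addNr !mulr0 !addr0.
Qed.

Lemma s_hatP (R : realType) (r n : nat) (S : {vspace 'rV[R]_n})
    (x : 'M[R]_(r, n)) :
  is_orth_proj (@tensor_lines R r n S) x (s_hat S x).
Proof.
rewrite /s_hat /orth_proj; apply: (@getPex _ [set p | is_orth_proj _ x p]).
have /boolp.choice[p pP] : forall j : 'I_r, exists p, p \in S /\
    forall t, t \in S -> frob_inner (row j x - p) t = 0.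
  by move=> j; have [p] := row_proj_exists S (row j x); exists p.
exists (\matrix_j p j); split.
  by move=> j; rewrite rowK; have [] := pP j.
move=> t tS; rewrite /frob_inner exchange_big /=; apply: big1 => j _.
have [_ /(_ _ (tS j)) p0] := pP j; rewrite -[RHS]p0 /frob_inner.
by apply: eq_bigr => i _; rewrite big_ord1 !mxE.
Qed.

(* Main.v *)
Require Import Defs.
From mathcomp Require Import all_boot all_order all_algebra.
From mathcomp Require Import all_classical all_reals all_analysis measurable_realfun.
From mathcomp Require Import ring lra.

(** Why the inequality holds.  Write [eps = X - s], let [Pi_m] be the orthogonal
    projection on the matrices that are constant on the blocks of [m], and let
    [D_m] be the number of blocks, which is also the dimension of [S_m].

    Lower bound on the oracle.  By Pythagoras the risk of the projection
    estimator on [m] is [|s - Pi_m s|^2 + E |Pi_m eps|^2].  A column of [eps] has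
    variance [1 - sum_j s_ji^2 >= rho], because the entries of [s] are at most
    [1 - rho], and different columns are uncorrelated; hence the second term is
    at least [rho * D_m].  So it suffices to bound the risk of the selected
    estimator by a constant times [|s - Pi_m s|^2 + pen m + 1]: the quotient of
    [pen m + 1] by [D_m] is at most of order [ln n], whence the logarithm of the
    statement.

    Upper bound.  Comparing the penalized criterion at the selected partition
    [m'] and at [m] bounds the loss by the bias of [m], by [pen m - pen m'] and
    by a noise term [2 <eps, p - q>], where [p - q] is constant on the blocks of
    the common refinement of [m] and [m'].  That term is absorbed by a fraction
    of the loss plus a multiple of [|Pi eps|^2] for the projection [Pi] on this
    refinement.  An interval partition is determined by the left endpoints of
    its blocks, and the refinement by the union [B] of two such sets of
    endpoints, so it is enough to control [|Pi_B eps|^2] for all sets [B] of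
    integers at once ([max_deviation_mean]).

    The key estimate is [E exp (|Pi_B eps|^2 / 32) <= exp (D / 8)] for a partition
    with [D] blocks, with constants that depend neither on [r] nor on the law
    ([block_chaos_exp_moment]).  It comes from integrating out one column at a
    time: if [e] is a centred one-hot vector, then
    [E exp (a |x + e|^2) <= exp (2 a + (a + 16 a^2) |x|^2)]
    ([multinomial_exp_sqr]).  Adding a column thus only inflates the coefficient
    [a] of the squared norm of the block sum, and the sequence
    [a_u = 1 / (16 (N + u))] with [u <= N] satisfies
    [a_u + 16 a_u^2 <= a_(u-1)], so that the coefficients stay of order [1 / N]
    during the [N] steps needed by a block of size [N].

    A union bound finishes the proof: there are at most [exp (D ln (n/D) + D)]
    sets [B] with [D] elements ([bin_le_expR]), and the penalty dominates a
    multiple of this exponent as soon as [c1 >= 128] and [c2 >= 384]. *)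

Set Implicit Arguments.
Unset Strict Implicit.
Unset Printing Implicit Defensive.

Import Order.TTheory GRing.Theory Num.Theory.
Import numFieldNormedType.Exports.

Local Open Scope classical_set_scope.
Local Open Scope ring_scope.

(** * One centred one-hot vector *)

Lemma sum_sqr_ge0 (R : realType) (I : finType) (P : pred I) (f : I -> R) :
  0 <= \sum_(i | P i) f i ^+ 2.
Proof. by apply: sumr_ge0 => i _; exact: sqr_ge0. Qed.

Lemma sum_cauchy_schwarz (R : realType) (I : finType) (a b : I -> R) :
  (\sum_i a i * b i) ^+ 2 <= (\sum_i a i ^+ 2) * (\sum_i b i ^+ 2).
Proof.
have : 0 <= \sum_i \sum_j (a i * b j - a j * b i) ^+ 2.
  by apply: sumr_ge0 => i _; exact: sum_sqr_ge0.
have -> : \sum_i \sum_j (a i * b j - a j * b i) ^+ 2 =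
    2 * ((\sum_i a i ^+ 2) * (\sum_i b i ^+ 2) - (\sum_i a i * b i) ^+ 2).
  rewrite expr2 !big_distrlr /= -sumrB.
  under [in RHS]eq_bigr do rewrite -sumrB.
  transitivity (\sum_i \sum_j (a i ^+ 2 * b j ^+ 2 - a i * b i * (a j * b j)) +
     \sum_i \sum_j (a j ^+ 2 * b i ^+ 2 - a i * b i * (a j * b j))).
    rewrite -big_split; apply: eq_bigr => i _; rewrite -big_split.
    by apply: eq_bigr => j _ /=; ring.
  rewrite mulr_natl mulr2n; congr (_ + _); rewrite exchange_big /=.
  by apply: eq_bigr => i _; apply: eq_bigr => j _; ring.
by rewrite pmulr_rge0 // subr_ge0.
Qed.

(** Taking expectations removes the linear term, so this gives the sub-Gaussian
    bound [E exp Y <= exp (2 b^2)] for a centred [Y] with [|Y| <= b]. *)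
Lemma expR_le_addr_sqr (R : realType) (y : R) : expR y <= y + expR (2 * y ^+ 2).
Proof.
(* For [y >= 1/2] the square alone dominates; below, [exp y <= 1 / (1 - y)]. *)
have [y2|y2] := leP y (1 / 2); last first.
  have : expR y <= expR (2 * y ^+ 2) by rewrite ler_expR; nra.
  by lra.
have h1 : 1 - y <= (expR y)^-1 by rewrite -expRN; exact: expR_ge1Dx.
have h2 : expR y <= (1 - y)^-1.
  by rewrite -[leLHS]invrK lef_pV2 // posrE ?invr_gt0 ?expR_gt0 //; lra.
have h3 : (1 - y)^-1 <= 1 + y + 2 * y ^+ 2.
  rewrite -[leLHS]mul1r ler_pdivrMr; last by lra.
  have : 0 <= y ^+ 2 * (1 - 2 * y) by apply: mulr_ge0; [exact: sqr_ge0|lra].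
  by lra.
have := expR_ge1Dx (2 * y ^+ 2); lra.
Qed.

Lemma expR_le2 (R : realType) (y : R) : y <= 1 / 2 -> expR y <= 2.
Proof.
move=> y2; have := expR_ge1Dx (- y); rewrite expRN => h.
rewrite -[leLHS]invrK -[leRHS]invrK lef_pV2 ?posrE ?invr_gt0 ?expR_gt0 //.
lra.
Qed.

Section OneStep.
Variables (R : realType) (r : nat) (p : 'I_r -> R).
Hypotheses (p_ge0 : forall j, 0 <= p j) (p_sum : \sum_j p j = 1).

Let e (j k : 'I_r) : R := (j == k)%:R - p k.

Lemma sum_mul_delta (j : 'I_r) (f : 'I_r -> R) :
  \sum_k (j == k)%:R * f k = f j.
Proof.
rewrite (bigD1 j) //= eqxx mul1r big1 ?addr0 // => k.
by rewrite eq_sym => /negPf ->; rewrite mul0r.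
Qed.

Lemma multinomial_mean (f : 'I_r -> R) :
  \sum_j p j * (\sum_k f k * e j k) = 0.
Proof.
have E j : \sum_k f k * e j k = f j - \sum_k f k * p k.
  rewrite -[X in X - _](sum_mul_delta j f) -sumrB; apply: eq_bigr => k _.
  by rewrite mulrBr [in RHS]mulrC.
under eq_bigr do rewrite E mulrBr.
rewrite sumrB -mulr_suml p_sum mul1r.
by apply/eqP; rewrite subr_eq0; apply/eqP/eq_bigr => k _; rewrite mulrC.
Qed.

Lemma multinomial_sqrE (j : 'I_r) :
  \sum_k e j k ^+ 2 = 1 - 2 * p j + \sum_k p k ^+ 2.
Proof.
rewrite -[X in X - _](sum_mul_delta j (fun=> 1)).
rewrite -(sum_mul_delta j p) mulr_sumr -sumrB -big_split; apply: eq_bigr => k _.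
by rewrite /e; case: (j == k) => /=; ring.
Qed.

Lemma prob_le1 (j : 'I_r) : p j <= 1.
Proof. by rewrite -p_sum (bigD1 j) //= lerDl sumr_ge0. Qed.

Lemma multinomial_sqr_le2 (j : 'I_r) : \sum_k e j k ^+ 2 <= 2.
Proof.
rewrite multinomial_sqrE.
suff : \sum_k p k ^+ 2 <= 1 by have := p_ge0 j; lra.
rewrite -p_sum; apply: ler_sum => k _.
by rewrite expr2 ler_piMl // prob_le1.
Qed.

Lemma multinomial_variance :
  \sum_j p j * (\sum_k e j k ^+ 2) = 1 - \sum_k p k ^+ 2.
Proof.
under eq_bigr do rewrite multinomial_sqrE mulrDr mulrBr mulr1 mulrCA -expr2.
by rewrite big_split sumrB /= -mulr_sumr -mulr_suml p_sum; ring.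
Qed.

(** This is where the hypothesis on [s] enters: it keeps every coordinate away
    from a deterministic one. *)
Lemma multinomial_variance_ge (rho : R) : (forall j, p j <= 1 - rho) ->
  rho <= \sum_j p j * (\sum_k e j k ^+ 2).
Proof.
move=> ple; rewrite multinomial_variance.
suff : \sum_k p k ^+ 2 <= 1 - rho by lra.
have -> : 1 - rho = \sum_k (1 - rho) * p k by rewrite -mulr_sumr p_sum mulr1.
by apply: ler_sum => k _; rewrite expr2 ler_wpM2r.
Qed.

(** Expanding the square, [|x + e|^2 = |x|^2 + 2 <x, e> + |e|^2] with
    [|e|^2 <= 2]; the exponential of the centred variable [2 a <x, e>] is handled
    by its variance proxy [4 a^2 * 2 |x|^2].  No dimension appears because only
    the norm of [e] is used. *)
Lemma multinomial_exp_sqr (x : 'I_r -> R) (a : R) : 0 <= a ->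
  \sum_j p j * expR (a * \sum_k (x k + e j k) ^+ 2) <=
  expR (2 * a + (a + 16 * a ^+ 2) * \sum_k x k ^+ 2).
Proof.
move=> a0; set X2 := \sum_k x k ^+ 2.
pose y j := 2 * a * \sum_k x k * e j k.
have yle j : y j ^+ 2 <= 8 * a ^+ 2 * X2.
  have CS := sum_cauchy_schwarz x (e j).
  have h : X2 * \sum_k e j k ^+ 2 <= X2 * 2.
    by rewrite ler_wpM2l ?sum_sqr_ge0 // multinomial_sqr_le2.
  rewrite /y exprMn.
  have -> : 8 * a ^+ 2 * X2 = (2 * a) ^+ 2 * (X2 * 2) by ring.
  by rewrite ler_wpM2l ?sqr_ge0 // (le_trans CS).
have sq j : a * \sum_k (x k + e j k) ^+ 2 <= (2 * a + a * X2) + y j.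
  have -> : \sum_k (x k + e j k) ^+ 2 =
      X2 + 2 * (\sum_k x k * e j k) + \sum_k e j k ^+ 2.
    rewrite mulr_sumr -!big_split; apply: eq_bigr => k _ /=.
    by rewrite sqrrD mulr_natl.
  rewrite /y; have := ler_wpM2l a0 (multinomial_sqr_le2 j); lra.
have -> : 2 * a + (a + 16 * a ^+ 2) * X2 = (2 * a + a * X2) + 16 * a ^+ 2 * X2.
  by ring.
rewrite expRD; set M := expR (2 * a + a * X2).
apply: (@le_trans _ _ (\sum_j M * (p j * y j + p j * expR (16 * a ^+ 2 * X2)))).
  apply: ler_sum => j _; rewrite -mulrDr mulrCA ler_wpM2l //.
  apply: (@le_trans _ _ (M * expR (y j))).
    by rewrite /M -expRD ler_expR.
  rewrite ler_wpM2l ?expR_ge0 // (le_trans (expR_le_addr_sqr _)) // lerD2l.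
  by rewrite ler_expR; have := yle j; lra.
rewrite -mulr_sumr big_split /= -[X in _ + X]mulr_suml p_sum mul1r.
have -> : \sum_j p j * y j = 0.
  transitivity (2 * a * \sum_j p j * (\sum_k x k * e j k)).
    by rewrite [RHS]mulr_sumr; apply: eq_bigr => j _; rewrite /y mulrCA.
  by rewrite multinomial_mean mulr0.
by rewrite add0r.
Qed.

End OneStep.

(** * Block averages and Frobenius geometry *)

Section BlockAverage.
Variables (R : realType) (r n : nat) (K : finType) (c : 'I_n -> K).
Implicit Types x y t : 'M[R]_(r, n).

Definition block_size (k : K) : nat := #|[pred l | c l == k]|.

Definition block_avg x : 'M[R]_(r, n) :=
  \matrix_(j, i) ((\sum_(l | c l == c i) x j l) / (block_size (c i))%:R).

Definition block_const t : Prop :=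
  forall j i l, c i = c l -> t j i = t j l.

Definition nblocks : nat := #|[set c i | i in 'I_n]%SET|.

Lemma block_size_gt0 i : (0 < block_size (c i))%N.
Proof. by apply/card_gt0P; exists i; rewrite inE. Qed.

Lemma block_size_neq0 i : (block_size (c i))%:R != 0 :> R.
Proof. by rewrite pnatr_eq0 -lt0n block_size_gt0. Qed.

Lemma sum_block_const (k : K) (a : R) :
  \sum_(l | c l == k) a = (block_size k)%:R * a.
Proof. by rewrite sumr_const mulr_natl. Qed.

(** The trace of the averaging operator, computed on the diagonal and by blocks. *)
Lemma sum_inv_block_size :
  \sum_i (block_size (c i))%:R^-1 = nblocks%:R :> R.
Proof.
rewrite (partition_big_imset c) /=.
rewrite /nblocks -sum1_card natr_sum; apply: eq_bigr => k /imsetP[i _ ->].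
rewrite (eq_bigr (fun=> (block_size (c i))%:R^-1)); last first.
  by move=> l /eqP ->.
by rewrite sum_block_const divff // block_size_neq0.
Qed.

Lemma block_avgB x y : block_avg (x - y) = block_avg x - block_avg y.
Proof.
apply/matrixP => j i; rewrite !mxE -mulrBl -sumrB; congr (_ / _).
by apply: eq_bigr => l _; rewrite !mxE.
Qed.

Lemma block_avg_const x : block_const (block_avg x).
Proof. by move=> j i l cil; rewrite !mxE cil. Qed.

Lemma block_constB x y :
  block_const x -> block_const y -> block_const (x - y).
Proof. by move=> cx cy j i l cil; rewrite !mxE (cx _ _ _ cil) (cy _ _ _ cil). Qed.

(** Averaging over the blocks is the orthogonal projection on the matrices that
    are constant on blocks. *)
Lemma frob_block_avg x t : block_const t ->
  frob_inner (block_avg x) t = frob_inner x t.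
Proof.
move=> tc; rewrite /frob_inner exchange_big [RHS]exchange_big /=.
apply: eq_bigr => j _; rewrite (partition_big_imset c) [RHS](partition_big_imset c) /=.
apply: eq_bigr => k /imsetP[i _ ->].
transitivity (\sum_(l | c l == c i) block_avg x j i * t j i).
  by apply: eq_bigr => l /eqP cl; rewrite (tc _ _ _ cl) (block_avg_const x j cl).
rewrite sum_block_const mxE mulrA mulrCA divff ?block_size_neq0 // mulr1 mulr_suml.
by apply: eq_bigr => l /eqP cl; rewrite (tc _ _ _ cl).
Qed.

Lemma frob_block_avg_sqr x :
  frob_inner (block_avg x) (block_avg x) =
  \sum_k (block_size k)%:R^-1 * \sum_j (\sum_(l | c l == k) x j l) ^+ 2.
Proof.
rewrite frob_block_avg; last exact: block_avg_const.
rewrite /frob_inner (partition_big c predT) //=; apply: eq_bigr => k _.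
rewrite exchange_big mulr_sumr; apply: eq_bigr => j _ /=.
rewrite expr2 mulrCA mulr_suml; apply: eq_bigr => l /eqP cl.
by rewrite mxE cl; congr (_ * _); rewrite mulrC.
Qed.

End BlockAverage.

Section Frobenius.
Variables (R : realType) (r n : nat).
Implicit Types x y t : 'M[R]_(r, n).

Lemma frobC x y : frob_inner x y = frob_inner y x.
Proof. by apply: eq_bigr => i _; apply: eq_bigr => j _; rewrite mulrC. Qed.

Lemma frobDl x y t : frob_inner (x + y) t = frob_inner x t + frob_inner y t.
Proof.
rewrite /frob_inner -big_split; apply: eq_bigr => i _ /=.
by rewrite -big_split; apply: eq_bigr => j _ /=; rewrite !mxE mulrDl.
Qed.

Lemma frobNl x t : frob_inner (- x) t = - frob_inner x t.
Proof.
rewrite /frob_inner -sumrN; apply: eq_bigr => i _ /=.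
by rewrite -sumrN; apply: eq_bigr => j _ /=; rewrite !mxE mulNr.
Qed.

Lemma frobBl x y t : frob_inner (x - y) t = frob_inner x t - frob_inner y t.
Proof. by rewrite frobDl frobNl. Qed.

Lemma frobDr x y t : frob_inner t (x + y) = frob_inner t x + frob_inner t y.
Proof. by rewrite frobC frobDl !(frobC t). Qed.

Lemma frobBr x y t : frob_inner t (x - y) = frob_inner t x - frob_inner t y.
Proof. by rewrite frobC frobBl !(frobC t). Qed.

Lemma frob_ge0 x : 0 <= frob_inner x x.
Proof.
by apply: sumr_ge0 => i _; apply: sumr_ge0 => j _; rewrite -expr2 sqr_ge0.
Qed.

Lemma frob_eq0 x : frob_inner x x = 0 -> x = 0.
Proof.
move=> x0; apply/matrixP => j i; rewrite mxE; apply/eqP; rewrite -sqrf_eq0.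
have h (k : 'I_n) : true -> 0 <= \sum_j x j k * x j k.
  by move=> _; apply: sumr_ge0 => l _; rewrite -expr2 sqr_ge0.
have h' (l : 'I_r) : true -> 0 <= x l i * x l i by rewrite -expr2 sqr_ge0.
move/(psumr_eq0P h): x0 => /(_ i isT) /(psumr_eq0P h') /(_ j isT).
by rewrite expr2 => ->.
Qed.

Lemma frob_normE x : frob_norm x ^+ 2 = frob_inner x x.
Proof. by rewrite sqr_sqrtr // frob_ge0. Qed.

Lemma frob_young x y :
  2 * frob_inner x y <= frob_inner x x / 4 + 4 * frob_inner y y.
Proof.
have := frob_ge0 (x - y - y - y - y).
by rewrite !(frobBl, frobBr) (frobC y x); lra.
Qed.

Lemma frob_sqrB x y :
  frob_inner (x - y) (x - y) <= 2 * frob_inner x x + 2 * frob_inner y y.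
Proof.
have := frob_ge0 (x + y).
by rewrite !(frobBl, frobBr, frobDl, frobDr) (frobC y x); lra.
Qed.

Lemma orth_proj_unique (V : set 'M[R]_(r, n)) x p q :
  (forall t u, V t -> V u -> V (t - u)) ->
  is_orth_proj V x p -> is_orth_proj V x q -> p = q.
Proof.
move=> VB [Vp pP] [Vq qP]; apply/eqP; rewrite -subr_eq0; apply/eqP/frob_eq0.
have Vpq := VB _ _ Vp Vq.
have := pP _ Vpq; have := qP _ Vpq; rewrite !frobBl; lra.
Qed.

End Frobenius.

(** * Independent columns as a finite product space *)

Section ProductModel.
Variables (R : realType) (r n : nat) (s : 'M[R]_(r, n)).
Hypotheses (s_ge0 : forall j i, 0 <= s j i) (s_sum : forall i, \sum_j s j i = 1).

Definition sample : predArgType := {ffun 'I_n -> 'I_r}.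
Implicit Types (w : sample) (F G : sample -> R).

Definition sample_prob w : R := \prod_i s (w i) i.

Definition sample_mean F : R := \sum_w sample_prob w * F w.

Definition resample w (i : 'I_n) (j : 'I_r) : sample :=
  [ffun l => if l == i then j else w l].

Definition one_hot w : 'M[R]_(r, n) := \matrix_(j, i) (w i == j)%:R.

Definition noise w : 'M[R]_(r, n) := one_hot w - s.

Lemma sample_prob_ge0 w : 0 <= sample_prob w.
Proof. by apply: prodr_ge0 => i _. Qed.

Lemma sample_mean_le F G : (forall w, F w <= G w) ->
  sample_mean F <= sample_mean G.
Proof.
by move=> FG; apply: ler_sum => w _; rewrite ler_wpM2l // sample_prob_ge0.
Qed.

Lemma sample_mean_sum (I : Type) (l : seq I) (P : pred I) (F : I -> sample -> R) :
  sample_mean (fun w => \sum_(i <- l | P i) F i w) =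
  \sum_(i <- l | P i) sample_mean (F i).
Proof.
rewrite exchange_big /=; apply: eq_bigr => w _.
by rewrite mulr_sumr.
Qed.

Lemma sample_meanD F G :
  sample_mean (fun w => F w + G w) = sample_mean F + sample_mean G.
Proof. by rewrite -big_split; apply: eq_bigr => w _; rewrite mulrDr. Qed.

Lemma sample_meanZ a F : sample_mean (fun w => a * F w) = a * sample_mean F.
Proof. by rewrite mulr_sumr; apply: eq_bigr => w _; rewrite mulrCA. Qed.

Lemma sample_mean_cst a : sample_mean (fun=> a) = a.
Proof.
rewrite /sample_mean -mulr_suml /sample_prob -(bigA_distr_bigA (fun i j => s j i)).
by rewrite big1 ?mul1r.
Qed.

(** Redrawing one column leaves the law invariant.  This replaces conditional
    expectations: it allows integrating out any single column. *)
Lemma sample_mean_resample F (i : 'I_n) :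
  sample_mean F = sample_mean (fun w => \sum_j s j i * F (resample w i j)).
Proof.
(* Exchanging the old and the new value of column [i] is an involution of the
   pairs (sample, new value) that preserves their weights. *)
pose sw (u : sample * 'I_r) := (resample u.1 i u.2, u.1 i).
have swK : involutive sw.
  case=> w j; rewrite /sw /= ffunE eqxx; congr pair; apply/ffunP => l.
  by rewrite !ffunE; case: eqP => // ->.
have probE w j : sample_prob (resample w i j) * s (w i) i = sample_prob w * s j i.
  rewrite /sample_prob (bigD1 i) //= [in RHS](bigD1 i) //= ffunE eqxx.
  rewrite mulrAC [RHS]mulrAC [s j i * _]mulrC; congr (_ * _).
  by apply: eq_bigr => l /negPf li; rewrite ffunE li.
transitivity (\sum_(u : sample * 'I_r) sample_prob u.1 * s u.2 i * F u.1).
  rewrite -(pair_bigA _ (fun w j => sample_prob w * s j i * F w)) /=.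
  by apply: eq_bigr => w _; rewrite -mulr_suml -mulr_sumr s_sum mulr1.
rewrite (reindex_inj (inv_inj swK)) /=.
under eq_bigr do rewrite probE.
rewrite -(pair_bigA _ (fun w j => sample_prob w * s j i * F (resample w i j))) /=.
by apply: eq_bigr => w _; rewrite mulr_sumr; apply: eq_bigr => j _; rewrite mulrA.
Qed.

Lemma noise_resample w i j k l : noise (resample w i j) k l =
  if l == i then (j == k)%:R - s k i else noise w k l.
Proof. by rewrite !mxE ffunE; have [->|] := eqVneq l i. Qed.

End ProductModel.

(** * The projected noise: exponential moment and mean *)

Section BlockChaos.
Variables (R : realType) (r n : nat) (s : 'M[R]_(r, n)).
Hypotheses (s_ge0 : forall j i, 0 <= s j i) (s_sum : forall i, \sum_j s j i = 1).
Variables (K : finType) (c : 'I_n -> K).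

Definition block_chaos (w : sample r n) : R :=
  frob_inner (block_avg c (noise s w)) (block_avg c (noise s w)).

Let size (k : K) : R := (block_size c k)%:R.

Let seen (t : nat) (k : K) : nat := #|[pred l : 'I_n | (c l == k) && (l < t)%N]|.

Let psum (t : nat) (k : K) (w : sample r n) (j : 'I_r) : R :=
  \sum_(l | (c l == k) && (l < t)%N) noise s w j l.

(* The exponent after the first [t] columns are revealed.  With [u] of the [N]
   columns of a block seen, the coefficient of its squared sum is
   [1 / (16 (N + u))], and [(N - u) / (8 N)] collects the constants left by the
   [N - u] columns that are integrated out. *)
Let potential (t : nat) (w : sample r n) : R :=
  \sum_k ((16 * (size k + (seen t k)%:R))^-1 * (\sum_j psum t k w j ^+ 2) +
          (8 * size k)^-1 * (size k - (seen t k)%:R)).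

Let seenS (i : 'I_n) k : seen i.+1 k = (seen i k + (c i == k))%N.
Proof.
rewrite /seen -!sum1_card; have [cik|cik] := eqVneq (c i) k.
  rewrite (bigD1 i) /=; last by rewrite inE cik eqxx ltnS leqnn.
  rewrite addnC; congr (_ + _)%N; apply: eq_bigl => l.
  by rewrite !inE ltnS [in RHS]ltn_neqAle -andbA [(_ <= _)%N && _]andbC.
rewrite addn0; apply: eq_bigl => l; rewrite !inE ltnS leq_eqVlt.
have [li|//] := eqVneq (l : nat) i.
by rewrite (ord_inj li) (negPf cik).
Qed.

Let psumS (i : 'I_n) k w j j' : psum i.+1 k (resample w i j) j' =
  psum i k w j' + (if c i == k then (j == j')%:R - s j' i else 0).
Proof.
rewrite /psum; have [cik|cik] := eqVneq (c i) k.
  rewrite (bigD1 i) /=; last by rewrite cik eqxx ltnS leqnn.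
  rewrite addrC noise_resample eqxx; congr (_ + _); apply: eq_big => l.
    by rewrite ltnS [in RHS]ltn_neqAle -andbA [(_ <= _)%N && _]andbC.
  by move=> /andP[_ /negPf li]; rewrite noise_resample li.
rewrite addr0; apply: eq_big => l.
  rewrite ltnS leq_eqVlt; have [li|//] := eqVneq (l : nat) i.
  by rewrite (ord_inj li) (negPf cik).
move=> /andP[/eqP cl _]; rewrite noise_resample.
by have [li|//] := eqVneq l i; rewrite -cl li eqxx in cik.
Qed.

Let coef_step (m u : R) : 1 <= m -> 0 <= u ->
  let a := (16 * (m + (u + 1)))^-1 in
  [/\ 0 <= a, 2 * a <= (8 * m)^-1 & a + 16 * a ^+ 2 <= (16 * (m + u))^-1].
Proof.
move=> m1 u0 /=; have h : 0 < m + (u + 1) by lra.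
have h' : 0 < m + u by lra.
split.
- by rewrite invr_ge0; lra.
- rewrite -[2]invrK -invfM lef_pV2 ?posrE; first lra; last by lra.
  by lra.
- have -> : (16 * (m + (u + 1)))^-1 + 16 * (16 * (m + (u + 1)))^-1 ^+ 2 =
     (m + u + 2) / (16 * (m + (u + 1)) ^+ 2).
    by field; lra.
  rewrite ler_pdivrMr; last by rewrite mulr_gt0 // exprn_gt0.
  rewrite -ler_pdivrMl ?invr_gt0; last by lra.
  by rewrite invrK; nra.
Qed.

(* Integrating out column [i] only affects the block of [i]: there
   [multinomial_exp_sqr] applies and [coef_step] closes the recursion. *)
Let potential_step (i : 'I_n) :
  sample_mean s (fun w => expR (potential i.+1 w)) <=
  sample_mean s (fun w => expR (potential i w)).
Proof.
rewrite (sample_mean_resample s_sum _ i); apply: sample_mean_le => // w.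
set k := c i.
have m1 : 1 <= size k by rewrite ler1n block_size_gt0.
have [a0 a1 a2] := coef_step m1 (ler0n R (seen i k)).
set a := (16 * _)^-1 in a0 a1 a2.
set d := (8 * size k)^-1 in a1.
pose rest := \sum_(l | l != k)
  ((16 * (size l + (seen i l)%:R))^-1 * (\sum_j psum i l w j ^+ 2) +
          (8 * size l)^-1 * (size l - (seen i l)%:R)).
set X2 := \sum_j psum i k w j ^+ 2.
have E j : potential i.+1 (resample w i j) =
    (rest + d * (size k - ((seen i k)%:R + 1))) +
    a * \sum_l (psum i k w l + ((j == l)%:R - s l i)) ^+ 2.
  rewrite /potential (bigD1 k) //= seenS eqxx natrD addrC -addrA; congr (_ + _).
    apply: eq_bigr => l /negPf lk; rewrite seenS eq_sym lk addn0.
    congr (_ * _ + _); apply: eq_bigr => j' _; congr (_ ^+ 2).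
    by rewrite psumS eq_sym lk addr0.
  rewrite [LHS]addrC; congr (_ + _ * _).
  apply: eq_bigr => j' _; congr (_ ^+ 2).
  by rewrite psumS eqxx.
under eq_bigr do rewrite E expRD mulrCA.
rewrite -mulr_sumr.
apply: (le_trans (ler_wpM2l (expR_ge0 _)
  (multinomial_exp_sqr (s_ge0^~ i) (s_sum i) (psum i k w) a0))).
rewrite -expRD ler_expR /potential (bigD1 k) //= -/X2 -/rest -/d.
have : (a + 16 * a ^+ 2) * X2 <= (16 * (size k + (seen i k)%:R))^-1 * X2.
  by rewrite ler_wpM2r // sum_sqr_ge0.
by lra.
Qed.

Let potential_start w : potential 0 w = (nblocks c)%:R / 8.
Proof.
rewrite -(sum_inv_block_size R c) (partition_big c predT) //= mulr_suml.
apply: eq_bigr => k _.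
have -> : seen 0 k = 0%N.
  by apply: eq_card0 => l; rewrite !inE ltn0 andbF.
rewrite big1 => [|j _]; last first.
  by rewrite /psum big_pred0 ?expr0n // => l; rewrite ltn0 andbF.
rewrite mulr0 add0r subr0 (eq_bigr (fun=> (size k)^-1)) => [|l /eqP <- //].
rewrite sum_block_const -/(size k).
by rewrite invfM -mulrA mulrC [X in X / _ = _]mulrC.
Qed.

Let potential_end w : potential n w = block_chaos w / 32.
Proof.
rewrite /block_chaos frob_block_avg_sqr mulr_suml; apply: eq_bigr => k _.
have -> : seen n k = block_size c k.
  by apply: eq_card => l; rewrite !inE ltn_ord andbT.
rewrite -/(size k) subrr mulr0 addr0.
have -> : \sum_j psum n k w j ^+ 2 =
          \sum_j (\sum_(l | c l == k) noise s w j l) ^+ 2.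
  apply: eq_bigr => j _; congr (_ ^+ 2); apply: eq_bigl => l.
  by rewrite ltn_ord andbT.
have -> : 16 * (size k + size k) = 32 * size k by ring.
by rewrite invfM -mulrA mulrC.
Qed.

(** Integrating the columns out from the last to the first can only increase the
    mean of the exponential, whose exponent goes from [block_chaos / 32] to the
    constant [nblocks / 8]. *)
Lemma block_chaos_exp_moment :
  sample_mean s (fun w => expR (block_chaos w / 32)) <= expR ((nblocks c)%:R / 8).
Proof.
have H t : (t <= n)%N -> sample_mean s (fun w => expR (potential t w)) <=
    expR ((nblocks c)%:R / 8).
  elim: t => [_|t IH tn].
    rewrite -[leRHS](sample_mean_cst s_sum).
    by apply: sample_mean_le => // w; rewrite potential_start.
  exact: le_trans (potential_step (Ordinal tn)) (IH (ltnW tn)).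
apply: le_trans (H n (leqnn n)); apply: sample_mean_le => // w.
by rewrite potential_end.
Qed.

Lemma noise_column_orthogonal i l : l != i ->
  sample_mean s (fun w => \sum_j noise s w j l * noise s w j i) = 0.
Proof.
move=> /negPf li; rewrite (sample_mean_resample s_sum _ i).
rewrite -[RHS](sample_mean_cst s_sum); congr sample_mean; apply/funext => w.
rewrite -[RHS](multinomial_mean (s_sum i) (fun k => noise s w k l)).
apply: eq_bigr => j _; congr (_ * _); apply: eq_bigr => k _.
by rewrite !noise_resample eqxx li.
Qed.

Lemma noise_column_variance_ge rho i : (forall j, s j i <= 1 - rho) ->
  rho <= sample_mean s (fun w => \sum_j noise s w j i * noise s w j i).
Proof.
move=> sle; rewrite (sample_mean_resample s_sum _ i).
rewrite -[leLHS](sample_mean_cst s_sum); apply: sample_mean_le => // w.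
apply: le_trans (multinomial_variance_ge (s_ge0^~ i) (s_sum i) sle) _.
rewrite le_eqVlt; apply/orP; left; apply/eqP; apply: eq_bigr => j _.
congr (_ * _); apply: eq_bigr => k _.
by rewrite !noise_resample eqxx expr2.
Qed.

(** Only the diagonal terms of the quadratic form [<Pi eps, eps>] have a nonzero
    mean, and their weights add up to the number of blocks. *)
Lemma block_chaos_mean_ge rho : (forall i j, s j i <= 1 - rho) ->
  rho * (nblocks c)%:R <= sample_mean s block_chaos.
Proof.
move=> sle.
have -> : block_chaos = fun w => \sum_i (block_size c (c i))%:R^-1 *
    \sum_(l | c l == c i) \sum_j noise s w j l * noise s w j i.
  apply/funext => w.
  rewrite /block_chaos frob_block_avg; last exact: block_avg_const.
  rewrite frobC /frob_inner; apply: eq_bigr => i _.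
  rewrite exchange_big mulr_sumr; apply: eq_bigr => j _ /=.
  by rewrite mxE -mulr_suml mulrCA mulrA.
rewrite sample_mean_sum -(sum_inv_block_size R c) mulr_sumr.
apply: ler_sum => i _; rewrite sample_meanZ mulrC ler_wpM2l ?invr_ge0 //.
rewrite sample_mean_sum (bigD1 i) //= big1 ?addr0; last first.
  by move=> l /andP[_ li]; exact: noise_column_orthogonal.
exact: noise_column_variance_ge.
Qed.

End BlockChaos.

(** * Uniform control over all sets of breakpoints *)

Section Traces.
Variable n : nat.
Implicit Types (A B : {set 'I_n}) (i l : 'I_n).

(** The labels of the partition with breakpoints [B]: two points are in the same
    block when the same breakpoints precede them.  Labelling by sets rather than
    by ranks makes refinement a matter of intersecting labels. *)
Definition trace B i : {set 'I_n} := [set b in B | (b <= i)%N]%SET.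

Lemma in_trace B i b : (b \in trace B i) = (b \in B) && (b <= i)%N.
Proof. by rewrite inE. Qed.

Lemma trace_sub A B i l : A \subset B -> trace B i = trace B l ->
  trace A i = trace A l.
Proof.
move=> AB Bil; apply/setP => b; rewrite !in_trace; case bA: (b \in A) => //=.
have := congr1 (fun U : {set 'I_n} => b \in U) Bil.
by rewrite !in_trace (fintype.subsetP AB).
Qed.

(** The traces form a chain of subsets of [B], so they are told apart by their
    cardinality; the extra one is the block before the first breakpoint. *)
Lemma nblocks_trace B : (nblocks (trace B) <= #|B|.+1)%N.
Proof.
pose f (U : {set 'I_n}) : 'I_#|B|.+1 := inord #|U|.
have tle i : (#|trace B i| <= #|B|)%N.
  by apply: subset_leq_card; apply/fintype.subsetP => b; rewrite inE => /andP[].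
have mono i l : (i <= l)%N -> trace B i \subset trace B l.
  move=> il; apply/fintype.subsetP => b; rewrite !inE => /andP[-> bi].
  exact: leq_trans il.
rewrite /nblocks -[leqRHS]card_ord -(@card_in_imset _ _ f); first exact: max_card.
have inj i l : (i <= l)%N -> #|trace B i| = #|trace B l| -> trace B i = trace B l.
  by move=> il E; apply/eqP; rewrite eqEcard mono //= E.
move=> _ _ /imsetP[i _ ->] /imsetP[l _ ->] /(congr1 (@nat_of_ord _)).
rewrite /f !inordK ?ltnS ?tle // => E.
by have [/inj->|/ltnW/inj->] := leqP i l.
Qed.

End Traces.

(** One term of the binomial expansion of [(1 + D/n)^n <= exp D]. *)
Lemma bin_le_expR (R : realType) (n D : nat) : (0 < n)%N ->
  ('C(n, D))%:R <= expR (D%:R * ln (n%:R / D%:R) + D%:R) :> R.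
Proof.
move=> n0; case: D => [|D]; first by rewrite mul0r addr0 expR0 bin0.
have [Dn|Dn] := leqP D.+1 n; last by rewrite bin_small // expR_ge0.
set d : R := D.+1%:R; set m : R := n%:R.
have d0 : 0 < d by rewrite ltr0n.
have m0 : 0 < m by rewrite ltr0n.
have h1 : (1 + d / m) ^+ n <= expR d.
  have dE : d = n%:R * (d / m) by rewrite mulrC divfK // gt_eqF.
  rewrite [X in expR X]dE expRM_natl.
  rewrite ler_pXn2r ?nnegrE ?expR_ge0 ?expR_ge1Dx //.
  by rewrite addr_ge0 // ltW // divr_gt0.
have h2 : (d / m) ^+ D.+1 * ('C(n, D.+1))%:R <= (1 + d / m) ^+ n.
  have lt : (D.+1 < n.+1)%N by [].
  rewrite exprDn (bigD1 (Ordinal lt)) //= expr1n mul1r mulr_natr lerDl.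
  apply: sumr_ge0 => i _; rewrite expr1n mul1r mulrn_wge0 // exprn_ge0 //.
  by rewrite ltW // divr_gt0.
rewrite expRD expRM_natl lnK ?posrE ?divr_gt0 //.
have -> : ('C(n, D.+1))%:R = (m / d) ^+ D.+1 * ((d / m) ^+ D.+1 * ('C(n, D.+1))%:R).
  rewrite mulrA -exprMn mulrA divfK ?gt_eqF // divff ?gt_eqF //.
  by rewrite expr1n mul1r.
rewrite ler_wpM2l ?exprn_ge0 //; first by rewrite ltW // divr_gt0.
exact: le_trans h2 h1.
Qed.

Section Deviations.
Variables (R : realType) (r n : nat) (s : 'M[R]_(r, n)).
Hypotheses (s_ge0 : forall j i, 0 <= s j i) (s_sum : forall i, \sum_j s j i = 1).
Hypothesis n_gt0 : (0 < n)%N.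

(** Up to constants, the logarithm of the number of sets of [D] breakpoints.  The
    coefficient [3] leaves room for [D] from [bin_le_expR], for [D / 8] from
    [block_chaos_exp_moment] and for a geometric factor. *)
Definition entropy (D : nat) : R := D%:R * ln (n%:R / D%:R) + 3 * D%:R.

(** A soft maximum over [B]: a sum is easier to integrate than a supremum, and
    [y <= exp y] makes it an upper bound. *)
Definition max_deviation (w : sample r n) : R :=
  \sum_(B : {set 'I_n}) expR (block_chaos s (trace B) w / 32 - entropy #|B|).

Lemma block_chaos_le (B : {set 'I_n}) w :
  block_chaos s (trace B) w <= 32 * (entropy #|B| + max_deviation w).
Proof.
have := expR_ge1Dx (block_chaos s (trace B) w / 32 - entropy #|B|).
have : expR (block_chaos s (trace B) w / 32 - entropy #|B|) <= max_deviation w.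
  rewrite /max_deviation (bigD1 B) //= lerDl; apply: sumr_ge0 => A _.
  exact: expR_ge0.
lra.
Qed.

Lemma geometric_sum_le2 (m : nat) : \sum_(i < m) (1 / 2 : R) ^+ i <= 2.
Proof.
have -> : \sum_(i < m) (1 / 2 : R) ^+ i = 2 - 2 * (1 / 2) ^+ m.
  elim: m => [|m IH]; first by rewrite big_ord0 expr0; lra.
  by rewrite big_ord_recr /= IH exprS; lra.
have : 0 <= (1 / 2 : R) ^+ m by rewrite exprn_ge0 //; lra.
lra.
Qed.

Lemma max_deviation_mean : sample_mean s max_deviation <= 4.
Proof.
rewrite /max_deviation sample_mean_sum.
pose b D : R := expR (D.+1%:R / 8 - entropy D).
apply: (@le_trans _ _ (\sum_(B : {set 'I_n}) b #|B|)).
  apply: ler_sum => B _.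
  have -> : (fun w => expR (block_chaos s (trace B) w / 32 - entropy #|B|)) =
     (fun w => expR (- entropy #|B|) * expR (block_chaos s (trace B) w / 32)).
    by apply/funext => w; rewrite -expRD addrC.
  rewrite sample_meanZ /b expRD mulrC ler_wpM2r ?expR_ge0 //.
  apply: le_trans (block_chaos_exp_moment s_ge0 s_sum (trace B)) _.
  rewrite ler_expR ler_wpM2r ?invr_ge0 //.
  by rewrite ler_nat nblocks_trace.
have cB (B : {set 'I_n}) : (#|B| < n.+1)%N.
  by rewrite ltnS -[leqRHS]card_ord max_card.
rewrite (partition_big (fun B : {set 'I_n} => Ordinal (cB B)) predT) //=.
apply: (@le_trans _ _ (\sum_(D < n.+1) 2 * (1 / 2) ^+ D)); last first.
  by rewrite -mulr_sumr; have := geometric_sum_le2 n.+1; lra.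
apply: ler_sum => D _.
rewrite (eq_bigr (fun=> b D)) => [|B /eqP <- //].
rewrite sumr_const -[leLHS]mulr_natl.
have -> : #|[pred B : {set 'I_n} | Ordinal (cB B) == D]| = 'C(n, D).
  have := card_draws 'I_n D; rewrite card_ord => <-; apply: eq_card => B.
  by rewrite !inE -val_eqE.
apply: (@le_trans _ _ (expR (D%:R * ln (n%:R / D%:R) + D%:R) * b D)).
  by rewrite ler_wpM2r ?expR_ge0 // bin_le_expR.
have h1 : expR (1 / 8) <= 2 :> R by apply: expR_le2; lra.
have h2 : expR (- (15 / 8)) <= 1 / 2 :> R.
  rewrite expRN div1r lef_pV2 ?posrE ?expR_gt0 //.
  by have := expR_ge1Dx (15 / 8 : R); lra.
rewrite -expRD.
(* After the cancellation of the logarithms, each cardinality [D] contributes at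
   most [exp (1/8 - 15 D / 8)]. *)
have -> : D%:R * ln (n%:R / D%:R) + D%:R + (D.+1%:R / 8 - entropy D) =
    1 / 8 + D%:R * (- (15 / 8)) :> R.
  by rewrite /entropy -natr1; lra.
rewrite expRD expRM_natl ler_pM ?exprn_ge0 ?expR_ge0 //.
by rewrite lerXn2r ?nnegrE ?expR_ge0 //; lra.
Qed.

Lemma entropy_ge0 (D : nat) : (0 < D)%N -> (D <= n)%N -> 0 <= entropy D.
Proof.
move=> D0 Dn; rewrite /entropy addr_ge0 ?mulr_ge0 //.
by rewrite ln_ge0 // ler_pdivlMr ?ltr0n // mul1r ler_nat.
Qed.

(** [ln (n / D)] decreases in [D], so replacing [B] by [D] or [D'] inside the
    logarithm is harmless. *)
Lemma entropy_union (B D D' : nat) : (0 < D)%N -> (0 < D')%N ->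
  (D <= B)%N -> (D' <= B)%N -> (B <= D + D')%N -> (B <= n)%N ->
  entropy B <= entropy D + entropy D'.
Proof.
move=> D0 D'0 DB D'B BD Bn.
have B0 : (0 < B)%N by exact: leq_trans DB.
have nR : (0 : R) < n%:R by rewrite ltr0n.
have mono (k : nat) : (0 < k)%N -> (k <= B)%N ->
    ln (n%:R / B%:R) <= ln (n%:R / k%:R) :> R.
  move=> k0 kB; rewrite ler_ln ?posrE ?divr_gt0 ?ltr0n //.
  by rewrite ler_wpM2l ?ler0n // lef_pV2 ?posrE ?ltr0n // ler_nat.
have L0 : 0 <= ln (n%:R / B%:R) :> R.
  by rewrite ln_ge0 // ler_pdivlMr ?ltr0n // mul1r ler_nat.
have BDR : B%:R <= D%:R + D'%:R :> R by rewrite -natrD ler_nat.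
have h1 := ler_wpM2l (ler0n R D) (mono D D0 DB).
have h2 := ler_wpM2l (ler0n R D') (mono D' D'0 D'B).
have h3 := ler_wpM2r L0 BDR.
rewrite /entropy; lra.
Qed.

End Deviations.

(** * Interval partitions *)

Section IntervalPartitions.
Variables (R : realType) (n : nat) (m : {set {set 'I_n}}).
Hypothesis mEI : m \in EI_collection n.

Let block (i : 'I_n) : {set 'I_n} := finset.pblock m i.

Let mpart : finset.partition m [set: 'I_n]%SET.
Proof. by move: mEI; rewrite inE => /andP[]. Qed.

Let mtriv : finset.trivIset m.
Proof. by case/and3P: mpart. Qed.

Let in_cover (i : 'I_n) : i \in finset.cover m.
Proof. by case/and3P: mpart => /eqP -> _ _; rewrite inE. Qed.

Let mem_block (i : 'I_n) : i \in block i.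
Proof. by rewrite /block finset.mem_pblock in_cover. Qed.

Let block_mem (i : 'I_n) : block i \in m.
Proof. exact: finset.pblock_mem. Qed.

Let block_eq (i l : 'I_n) : l \in block i -> block l = block i.
Proof. by move=> li; rewrite /block (finset.same_pblock mtriv li). Qed.

Let blockE (J : {set 'I_n}) (i : 'I_n) : J \in m -> i \in J -> block i = J.
Proof. exact: finset.def_pblock. Qed.

Let block_interval (J : {set 'I_n}) : J \in m ->
  exists a b : 'I_n, [/\ a \in J & forall i, (i \in J) = (a <= i <= b)%N].
Proof.
move=> Jm; move: mEI; rewrite inE => /andP[/and3P[_ _ m0] /'forall_implyP/(_ J Jm)].
move=> /existsP[a /existsP[b /eqP E]]; exists a, b; split; last first.
  by move=> i; rewrite E inE.
have /finset.set0Pn[i] : J != finset.set0 by apply: contraNneq m0 => <-.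
rewrite E !inE leqnn /= => /andP[]; exact: leq_trans.
Qed.

Definition starts : {set 'I_n} :=
  [set i | [forall l in finset.pblock m i, (i <= l)%N]]%SET.

Let start_exists (J : {set 'I_n}) : J \in m ->
  exists2 a, a \in J & a \in starts.
Proof.
move=> Jm; have [a [b [aJ E]]] := block_interval Jm; exists a => //.
rewrite inE; apply/'forall_implyP => l.
by rewrite -/(block a) (blockE Jm aJ) E => /andP[].
Qed.

Let startP (i l : 'I_n) : i \in starts -> l \in block i -> (i <= l)%N.
Proof. by rewrite inE => /'forall_implyP; apply. Qed.

Lemma nblocks_pblock : nblocks (finset.pblock m) = #|m|.
Proof.
apply: eq_card => J; apply/imsetP/idP => [[i _ ->]|Jm]; first exact: block_mem.
have [a aJ _] := start_exists Jm; exists a => //.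
exact: esym (blockE Jm aJ).
Qed.

Lemma card_starts : #|starts| = #|m|.
Proof.
rewrite -nblocks_pblock /nblocks -(@card_in_imset _ _ (finset.pblock m) starts).
  apply: eq_card => J; apply/imsetP/imsetP => -[i _ ->]; first by exists i.
  have [a ai aS] := start_exists (block_mem i).
  by exists a => //; apply/esym; exact: block_eq.
move=> i l iS lS il; apply/ord_inj/eqP; rewrite eqn_leq.
by rewrite !startP // /block ?il // -?il.
Qed.

(** Hence the blocks of [m] are coarser than those defined by any set of
    breakpoints containing [starts m]. *)
Lemma trace_starts (i l : 'I_n) : trace starts i = trace starts l ->
  finset.pblock m i = finset.pblock m l.
Proof.
wlog il : i l / (i <= l)%N => [H E|E].
  by have [/H|/ltnW/H/(_ (esym E))] := leqP i l; [exact|].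
(* The left end [b] of the block of [l] also precedes [i], and intervals are
   convex, so [i] lies in that block. *)
have [b bl bS] := start_exists (block_mem l).
have /(congr1 (fun U : {set 'I_n} => b \in U)) := E.
rewrite !in_trace bS /=.
have [x [y [_ J]]] := block_interval (block_mem l).
have [bil|bl'] := leqP b l; last first.
  have := startP bS (_ : l \in block b).
  by rewrite (block_eq bl) mem_block leqNgt bl' => /(_ isT).
move=> bi; apply: block_eq; rewrite J.
have := mem_block l; rewrite J => /andP[_ ly].
move: bl; rewrite J => /andP[xb _].
by rewrite (leq_trans xb) //= (leq_trans il).
Qed.

Let psi_block (i : 'I_n) (J : {set 'I_n}) : J \in m ->
  psi R J 0 i = (J == block i)%:R.
Proof.
move=> Jm; rewrite mxE; congr (_%:R); congr nat_of_bool.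
apply/idP/eqP => [iJ|->]; last exact: mem_block.
by rewrite (blockE Jm iJ).
Qed.

Lemma mem_EI_space (v : 'rV[R]_n) : v \in EI_space R m <->
  (forall i l, finset.pblock m i = finset.pblock m l -> v 0 i = v 0 l).
Proof.
split => [|vc].
  rewrite /EI_space; set X := [seq _ | _ <- _].
  move/(@coord_span _ _ _ (in_tuple X)) => -> i l il.
  rewrite !summxE; apply: eq_bigr => k _; rewrite !mxE; congr (_ * _).
  have : X`_k \in X by rewrite mem_nth.
  case/mapP => J; rewrite mem_enum => Jm ->.
  by rewrite !psi_block // /block il.
(* The default value [0] is for the empty set, which is not a block. *)
pose val_on (J : {set 'I_n}) : R := if [pick i in J] is Some i then v 0 i else 0.
suff -> : v = \sum_(J in m) val_on J *: psi R J.
  apply: memv_suml => J Jm; apply: memvZ; apply: memv_span.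
  by apply: map_f; rewrite mem_enum.
apply/rowP => i; rewrite summxE (bigD1 (block i)) //= big1 ?addr0.
  rewrite !mxE mem_block mulr1 /val_on; case: pickP => [l li|/(_ i)].
    by apply: vc; rewrite -/(block l) (block_eq li).
  by rewrite mem_block.
move=> J /andP[Jm /negPf Ji]; rewrite mxE psi_block //.
by rewrite Ji mulr0.
Qed.

Lemma dim_EI_space : \dim (EI_space R m) = #|m|.
Proof.
rewrite /EI_space; set X := [seq _ | _ <- _].
have sX : size X = #|m| by rewrite size_map cardE.
rewrite -sX; apply/eqP; rewrite -/(free X) -[X]/(tval (in_tuple X)).
apply/freeP => k k0 i.
have iX : (i < size (enum m))%N by rewrite -[X in (_ < X)%N](size_map (@psi R n)).
pose J := nth finset.set0 (enum m) i.
have Jm : J \in m by rewrite -mem_enum mem_nth.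
have [a aJ _] := start_exists Jm.
have := congr1 (fun v : 'rV[R]_n => v 0 a) k0.
rewrite summxE (bigD1 i) //= big1 ?addr0.
  by rewrite !mxE (nth_map finset.set0) // -/J mxE aJ mulr1.
move=> l li; have lX : (l < size (enum m))%N.
  by rewrite -[X in (_ < X)%N](size_map (@psi R n)).
rewrite mxE (nth_map finset.set0) // psi_block; last by rewrite -mem_enum mem_nth.
by rewrite (blockE Jm aJ) nth_uniq ?enum_uniq // val_eqE (negPf li) mulr0.
Qed.

Lemma tensor_EI_space (r : nat) (t : 'M[R]_(r, n)) :
  tensor_lines (EI_space R m) t <-> block_const (finset.pblock m) t.
Proof.
split=> [tS j i l il|tc j].
  by have /mem_EI_space/(_ i l il) := tS j; rewrite !mxE.
by apply/mem_EI_space => i l /tc E; rewrite !mxE.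
Qed.

Lemma s_hat_EI (r : nat) (x : 'M[R]_(r, n)) :
  s_hat (EI_space R m) x = block_avg (finset.pblock m) x.
Proof.
apply: (@orth_proj_unique _ _ _ (tensor_lines (EI_space R m)) x).
- move=> t u /tensor_EI_space tc /tensor_EI_space uc.
  exact/tensor_EI_space/block_constB.
- exact: s_hatP.
- split; first exact/tensor_EI_space/block_avg_const.
  move=> t /tensor_EI_space tc.
  by rewrite frobBl frob_block_avg // subrr.
Qed.

End IntervalPartitions.

(** * From the random matrix to the product space *)

Section Transfer.
Variables (R : realType) (d : measure_display) (T : measurableType d).
Variable P : probability T R.

(** Monotonicity holds for all nonnegative functions since their integral is a
    supremum over the simple functions below them; the loss of the selected
    estimator can thus be bounded without studying its measurability. *)
Lemma ge0_expectation_le (f g : T -> R) :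
  (forall w, 0 <= f w) -> (forall w, f w <= g w) -> ('E_P[f] <= 'E_P[g])%E.
Proof.
move=> f0 fg; have g0 w : 0 <= g w by exact: le_trans (f0 w) (fg w).
rewrite unlock !ge0_integralE; [|by move=> w _; rewrite lee_fin..].
apply: le_ereal_sup => _ [h hf <-]; exists h => // w.
by apply: le_trans (hf w) _; rewrite !patch_setT lee_fin.
Qed.

Variables (r n : nat) (X : 'I_r -> 'I_n -> {RV P >-> R}) (s : 'M[R]_(r, n)).
Hypothesis XP : is_model X s.

Let hit (j : 'I_r) (i : 'I_n) : set T := X j i @^-1` [set 1].

Let measurable_hit j i : measurable (hit j i).
Proof. exact: measurable_funPTI (measurable_set1 1). Qed.

Let X_indic j i w : X j i w = \1_(hit j i) w.
Proof.
have [X01 _ _ _] := XP; rewrite indicE /hit; case: (X01 j i w) => Xw.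
  rewrite memNset ?Xw //= /preimage /= Xw => /eqP.
  by rewrite eq_sym oner_eq0.
by rewrite mem_set ?Xw.
Qed.

Let hit_prob j i : P (hit j i) = (s j i)%:E.
Proof.
have [_ _ _ <-] := XP; rewrite -expectation_indic //.
by congr expectation; apply/funext => w; rewrite X_indic.
Qed.

Lemma model_ge0 j i : 0 <= s j i.
Proof. by rewrite -lee_fin -hit_prob measure_ge0. Qed.

Lemma model_sum i : \sum_j s j i = 1.
Proof.
have [_ X1 _ _] := XP.
apply: (@EFin_inj R); rewrite -sumEFin.
under eq_bigr do rewrite -hit_prob -(expectation_indic P (measurable_hit _ _)) unlock.
rewrite -ge0_integral_sum //.
- transitivity (\int[P]_w (1 : R)%:E)%E; last first.
    by have := expectation_cst P 1; rewrite unlock.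
  apply: eq_integral => w _.
  by rewrite sumEFin -(X1 i w); congr EFin; apply: eq_bigr => j _; rewrite X_indic.
- by move=> j; apply/measurable_EFinP; exact: measurable_indic.
Qed.

Lemma model_sample :
  exists W : T -> sample r n, forall w, obs_matrix X w = one_hot R (W w).
Proof.
have [X01 X1 _ _] := XP.
have colP w i : exists j, forall k, X k i w = (j == k)%:R.
  have [j Xj] : exists j, X j i w = 1.
    apply: contrapT => /forallNP none; have := X1 i w; rewrite big1 => [/eqP|j _].
      by rewrite eq_sym oner_eq0.
    by case: (X01 j i w) => // /none.
  exists j => k; have [<-//|jk] := eqVneq j k.
  have := X1 i w; rewrite (bigD1 j) //= Xj => /eqP.
  rewrite -[eqbRHS]addr0 (inj_eq (addrI _)) psumr_eq0 => [/allP/(_ k)|l _]; last first.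
    by case: (X01 l i w) => ->.
  by rewrite mem_index_enum eq_sym jk => /(_ isT) /eqP.
have /choice[W WP] : forall w, exists f : sample r n,
    forall i k, X k i w = (f i == k)%:R.
  move=> w; have /choice[f fP] := colP w.
  by exists [ffun i => f i] => i k; rewrite ffunE.
by exists W => w; apply/matrixP => k i; rewrite !mxE.
Qed.

Let coord_borel (j : 'I_r) :
  <<s @open 'cV[R]_r >> [set v : 'cV[R]_r | v j 0 = 1].
Proof.
rewrite -[X in <<s _ >> X]setCK.
suff : <<s @open 'cV[R]_r >> (~` [set v : 'cV[R]_r | v j 0 = 1]).
  by move=> h; rewrite -setTD; apply: sigma_algebraCD.
apply: sub_sigma_algebra; apply: closed_openC.
have -> : [set v : 'cV[R]_r | v j 0 = 1] = (fun v : 'cV[R]_r => v j 0) @^-1` [set 1].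
  by [].
apply: preimage_closed => [v _|]; first exact: coord_continuous.
exact: closed_eq.
Qed.

Variable W : T -> sample r n.
Hypothesis WP : forall w, obs_matrix X w = one_hot R (W w).

Let fibreE (o : sample r n) : W @^-1` [set o] = \bigcap_(i in [set: 'I_n]) hit (o i) i.
Proof.
have XW k i w : X k i w = (W w i == k)%:R.
  by have := congr1 (fun M : 'M[R]_(r, n) => M k i) (WP w); rewrite !mxE.
apply/seteqP; split => w /=.
  by move=> Ww i _; rewrite /hit /preimage /= XW Ww eqxx.
move=> H; apply/ffunP => i; have := H i I; rewrite /hit /preimage /= XW.
by case: eqP => // _ /eqP; rewrite eq_sym oner_eq0.
Qed.

Let measurable_fibre (o : sample r n) : measurable (W @^-1` [set o]).
Proof.
by rewrite fibreE; apply: fin_bigcap_measurable => // i _; exact: measurable_hit.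
Qed.

(* Independence is used once, for the events that column [i] equals the one-hot
   vector of [o i]; a one-hot column is recognized by its coordinate [o i]. *)
Let fibre_prob (o : sample r n) : P (W @^-1` [set o]) = (sample_prob s o)%:E.
Proof.
have [_ _ indep _] := XP.
have := indep [set: 'I_n]%SET (fun i => [set v : 'cV[R]_r | v (o i) 0 = 1])
  (fun i _ => coord_borel (o i)).
have E i : (fun w => col i (obs_matrix X w)) @^-1` [set v : 'cV[R]_r | v (o i) 0 = 1]
    = hit (o i) i.
  by apply/seteqP; split => w; rewrite /hit /preimage /= !mxE.
under eq_bigr do rewrite E hit_prob.
rewrite fibreE /sample_prob -prodEFin => H.
rewrite (eq_bigl xpredT) in H; last by move=> i; rewrite inE.
rewrite -H; congr (P _); apply/seteqP; split => w H' i _.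
  by rewrite E; exact: H'.
by rewrite -E; apply: H'; rewrite /= inE.
Qed.

Lemma expectation_sample (G : sample r n -> R) : (forall o, 0 <= G o) ->
  ('E_P[fun w => G (W w)] = (sample_mean s G)%:E)%E.
Proof.
move=> G0; rewrite unlock.
transitivity (\int[P]_w (\sum_(o : sample r n)
    ((G o)%:E * (\1_(W @^-1` [set o]) w)%:E))%E)%E.
  apply: eq_integral => w _; rewrite (bigD1 (W w)) //= big1 ?adde0.
    by rewrite indicE mem_set ?mule1.
  move=> o oW; rewrite indicE memNset ?mule0 // => /= Wo.
  by rewrite Wo eqxx in oW.
rewrite ge0_integral_sum //.
- rewrite /sample_mean -sumEFin; apply: eq_bigr => o _.
  rewrite ge0_integralZl_EFin //.
    rewrite integral_indic // setIT [X in (_ * X)%E]fibre_prob.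
    by rewrite -EFinM mulrC.
  by apply/measurable_EFinP; exact: measurable_indic.
- move=> o; apply: emeasurable_funM; first exact: measurable_cst.
  by apply/measurable_EFinP; exact: measurable_indic.
- by move=> o w _; rewrite -EFinM lee_fin mulr_ge0.
Qed.

End Transfer.

(** * The oracle inequality for one sample *)

Lemma EI_card_gt0 (n : nat) (m : {set {set 'I_n}}) :
  (0 < n)%N -> m \in EI_collection n -> (0 < #|m|)%N.
Proof.
move=> n0 mEI; rewrite -(nblocks_pblock mEI) card_gt0; apply/finset.set0Pn.
by exists (finset.pblock m (Ordinal n0)); exact: imset_f.
Qed.

Lemma EI_card_le (n : nat) (m : {set {set 'I_n}}) :
  m \in EI_collection n -> (#|m| <= n)%N.
Proof. by move=> mEI; rewrite -(card_starts mEI) -[leqRHS]card_ord max_card. Qed.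

Lemma gamma_block_avg (R : realType) (r n : nat) (K : finType) (c : 'I_n -> K)
    (x t : 'M[R]_(r, n)) :
  block_const c t -> gamma_n x (block_avg c x) <= gamma_n x t.
Proof.
move=> tc; rewrite /gamma_n !frob_normE -(frob_block_avg x tc).
rewrite -(@frob_block_avg _ _ _ _ _ x (block_avg c x) (@block_avg_const _ _ _ _ c x)).
have := frob_ge0 (block_avg c x - t).
by rewrite !(frobBl, frobBr) (frobC t); lra.
Qed.

Lemma basic_inequality (R : realType) (r n : nat) (s e p q : 'M[R]_(r, n)) (a b : R) :
  frob_inner p p - 2 * frob_inner (s + e) p + b <=
  frob_inner q q - 2 * frob_inner (s + e) q + a ->
  frob_inner (s - p) (s - p) + b <=
  frob_inner (s - q) (s - q) + a + 2 * frob_inner e (p - q).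
Proof. by rewrite !(frobBl, frobBr, frobDl) (frobC p s) (frobC q s); lra. Qed.

Section OracleInequality.
Variables (R : realType) (r n : nat) (s : 'M[R]_(r, n)).
Hypotheses (s_ge0 : forall j i, 0 <= s j i) (s_sum : forall i, \sum_j s j i = 1).
Hypothesis n_gt0 : (0 < n)%N.

Definition bias (m : {set {set 'I_n}}) : R :=
  let b := s - block_avg (finset.pblock m) s in frob_inner b b.

(** Pythagoras: [s - Pi s] is orthogonal to [Pi eps]. *)
Lemma projection_loss (m : {set {set 'I_n}}) (o : sample r n) :
  m \in EI_collection n ->
  frob_norm (s - s_hat (EI_space R m) (one_hot R o)) ^+ 2 =
  bias m + block_chaos s (finset.pblock m) o.
Proof.
move=> mEI; rewrite s_hat_EI // frob_normE /bias /block_chaos /=.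
set c := finset.pblock m.
have -> : s - block_avg c (one_hot R o) =
    (s - block_avg c s) - block_avg c (noise s o).
  by rewrite /noise block_avgB opprB addrA subrK.
have orth : frob_inner (s - block_avg c s) (block_avg c (noise s o)) = 0.
  by rewrite frobBl frob_block_avg ?subrr //; exact: block_avg_const.
move: (s - block_avg c s) (block_avg c (noise s o)) orth => b e orth.
by rewrite frobBl !frobBr (frobC e b) orth; lra.
Qed.

Lemma entropy_le_pen (c1 c2 : R) (m : {set {set 'I_n}}) :
  128 <= c1 -> 384 <= c2 -> m \in EI_collection n ->
  128 * entropy R n #|m| <= EI_pen c1 c2 m.
Proof.
move=> hc1 hc2 mEI; rewrite /EI_pen dim_EI_space // /entropy /=.
have D0 : (0 : R) < #|m|%:R by rewrite ltr0n EI_card_gt0.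
have L0 : 0 <= ln (n%:R / #|m|%:R) :> R.
  by rewrite ln_ge0 // ler_pdivlMr // mul1r ler_nat EI_card_le.
set D : R := #|m|%:R in D0 L0 *; set L := ln _ in L0 *.
have -> : 128 * (D * L + 3 * D) = D * (128 * L + 384) by ring.
by rewrite ler_wpM2l ?(ltW D0) // lerD // ler_wpM2r.
Qed.

(** The noise term is split by [frob_young]; a quarter of [|p - q|^2] costs at most
    half of the loss and half of the bias.  The noise projected on the common
    refinement costs [128 = 4 * 32] times the entropies of [m] and [m'], and the
    one of [m'] is cancelled by [- pen m']. *)
Lemma penalized_loss (c1 c2 : R) (m m' : {set {set 'I_n}}) (o : sample r n) :
  128 <= c1 -> 384 <= c2 -> m \in EI_collection n ->
  penalized_minimizer (EI_collection n) (@EI_space R n) (EI_pen c1 c2)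
    (one_hot R o) m' ->
  frob_norm (s - s_hat (EI_space R m') (one_hot R o)) ^+ 2 <=
  3 * bias m + 4 * EI_pen c1 c2 m + 256 * max_deviation s o.
Proof.
move=> hc1 hc2 mEI [m'EI /(_ m mEI)]; rewrite !s_hat_EI // !frob_normE.
set x := one_hot R o; set e := noise s o.
set p := block_avg (finset.pblock m') x.
set q := block_avg (finset.pblock m) s => minE.
have qmin : gamma_n x (block_avg (finset.pblock m) x) <= gamma_n x q.
  exact/gamma_block_avg/block_avg_const.
(* The breakpoints of the common refinement of [m] and [m']. *)
pose B := (starts m :|: starts m')%SET.
have sub (m0 : {set {set 'I_n}}) (t : 'M[R]_(r, n)) : m0 \in EI_collection n ->
    starts m0 \subset B -> block_const (finset.pblock m0) t ->
    block_const (trace B) t.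
  move=> m0EI sB tc j i l il; apply: tc; apply: trace_starts => //.
  exact: trace_sub sB il.
have pq : block_const (trace B) (p - q).
  apply: block_constB.
    by apply: (sub m') => //; [exact: finset.subsetUr | exact: block_avg_const].
  by apply: (sub m) => //; [exact: finset.subsetUl | exact: block_avg_const].
have young := frob_young (p - q) (block_avg (trace B) e).
rewrite frobC (frob_block_avg e pq) in young.
have chaos := block_chaos_le s B o; rewrite /block_chaos -/e in chaos.
have ent : entropy R n #|B| <= entropy R n #|m| + entropy R n #|m'|.
  apply: entropy_union => //; rewrite ?EI_card_gt0 //.
  - by rewrite -(card_starts mEI) subset_leq_card // finset.subsetUl.
  - by rewrite -(card_starts m'EI) subset_leq_card // finset.subsetUr.
  - by rewrite -(card_starts mEI) -(card_starts m'EI) cardsU leq_subr.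
  - by rewrite -[leqRHS]card_ord max_card.
have pen1 := entropy_le_pen hc1 hc2 mEI.
have pen2 := entropy_le_pen hc1 hc2 m'EI.
have tri := frob_sqrB (s - q) (s - p).
have pqE : (s - q) - (s - p) = p - q by rewrite opprB addrC addrA subrK.
rewrite pqE in tri.
rewrite /gamma_n !frob_normE in minE qmin.
have xE : x = s + e by rewrite /e /noise addrC subrK.
have loss : frob_inner (s - p) (s - p) + EI_pen c1 c2 m' <=
    bias m + EI_pen c1 c2 m + 2 * frob_inner e (p - q).
  apply: basic_inequality; rewrite -xE.
  by apply: le_trans minE _; rewrite lerD2r.
have bE : bias m = frob_inner (s - q) (s - q) by [].
lra.
Qed.

End OracleInequality.

(** * The risk bound *)

Lemma ln_ge_half (R : realType) (n : nat) : (2 <= n)%N -> 1 / 2 <= ln n%:R :> R.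
Proof.
move=> n2; rewrite -ler_expR lnK ?posrE ?ltr0n ?(ltnW n2) //.
by apply: le_trans (expR_le2 (lexx _)) _; rewrite ler_nat.
Qed.

Lemma EI_pen_le (R : realType) (n : nat) (c1 c2 : R) (m : {set {set 'I_n}}) :
  (2 <= n)%N -> 0 <= c1 -> 0 <= c2 -> m \in EI_collection n ->
  EI_pen c1 c2 m <= #|m|%:R * (ln n%:R * (c1 + 2 * c2)).
Proof.
move=> n2 c10 c20 mEI; rewrite /EI_pen dim_EI_space //=.
have n0 : (0 < n)%N by exact: ltnW.
have D0 := EI_card_gt0 n0 mEI.
rewrite ler_wpM2l // mulrDr.
have L : ln (n%:R / #|m|%:R) <= ln n%:R :> R.
  rewrite ler_ln ?posrE ?divr_gt0 ?ltr0n // ler_pdivrMr ?ltr0n //.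
  by rewrite ler_peMr // ler1n.
have h := ln_ge_half R n2.
apply: lerD; first by rewrite mulrC ler_wpM2r.
by rewrite mulrA ler_peMl //; lra.
Qed.

(** The final comparison: [b] is the bias, [V >= rho * D] the variance of the
    oracle, and [D * L >= 1/2] lets the additive constant [1024 = 256 * 4] be
    charged to the variance too. *)
Lemma oracle_constant (R : realType) (c1 c2 rho L D V b pen dev : R) :
  0 < rho -> 0 <= c1 -> 0 <= c2 -> 1 / 2 <= L -> 1 <= D -> 0 <= b ->
  rho * D <= V -> pen <= D * (L * (c1 + 2 * c2)) -> dev <= 4 ->
  3 * b + 4 * pen + 256 * dev <=
  (6 + (4 * (c1 + 2 * c2) + 2048) / rho) * L * (b + V).
Proof.
move=> rho0 c10 c20 L2 D1 b0 var hpen hdev.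
pose A := 4 * (c1 + 2 * c2) + 2048; rewrite -/A.
have A0 : 0 <= A / rho by rewrite divr_ge0 // /A; lra.
have L0 : 0 <= L by lra.
have LD : 1 / 2 <= D * L by nra.
have fit : 4 * pen + 1024 <= A / rho * L * V.
  apply: (@le_trans _ _ (A / rho * L * (rho * D))).
    have -> : A / rho * L * (rho * D) = A * (D * L) by field; lra.
    by rewrite /A; lra.
  by rewrite ler_wpM2l // mulr_ge0.
have V0 : 0 <= V.
  by apply: le_trans var; rewrite mulr_ge0 ?(ltW rho0) ?(le_trans ler01).
have LV : 0 <= L * V by rewrite mulr_ge0.
have Lb : 0 <= A / rho * L * b by rewrite mulr_ge0 // mulr_ge0.
have b_le : b <= 2 * L * b by rewrite ler_peMl //; lra.
lra.
Qed.

Theorem proposition1 (R : realType) :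
  exists kappa1 kappa2 : R,
    0 < kappa1 /\ 0 < kappa2 /\
    forall c1 c2 : R, kappa1 <= c1 -> kappa2 <= c2 ->
    forall rho : R, 0 < rho ->
    exists C : R, 0 < C /\
    forall n r : nat, (2 <= n)%N -> (2 <= r)%N ->
    forall s : 'M[R]_(r, n), (forall i j, s j i <= 1 - rho) ->
    forall (d : measure_display) (T : measurableType d) (P : probability T R)
      (X : 'I_r -> 'I_n -> {RV P >-> R}),
    is_model X s ->
    forall m_hat : T -> {set {set 'I_n}},
    (forall m, measurable [set w | m_hat w = m]) ->
    (forall w, penalized_minimizer (EI_collection n) (@EI_space R n)
                 (EI_pen c1 c2) (obs_matrix X w) (m_hat w)) ->
    let s_tilde := fun w => s_hat (EI_space R (m_hat w)) (obs_matrix X w) in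
    (quadratic_risk P s s_tilde <=
     (C * ln n%:R)%:E *
     ereal_inf [set quadratic_risk P s
                      (fun w => s_hat (EI_space R m) (obs_matrix X w))
               | m in [set` EI_collection n]])%E.
Proof.
exists 128, 384; rewrite !ltr0n; split=> //; split=> //.
move=> c1 c2 hc1 hc2 rho rho0.
pose A : R := 4 * (c1 + 2 * c2) + 2048.
have A0 : 0 < A by rewrite /A; lra.
have Arho : 0 < A / rho by rewrite divr_gt0.
exists (6 + A / rho); split; first by lra.
move=> n r n2 _ s sle d T P X XP m_hat _ m_hatP.
rewrite [X in is_true X]/=.
have n0 : (0 < n)%N by exact: ltnW.
have s_ge0 := model_ge0 XP; have s_sum := model_sum XP.
have [W WP] := model_sample XP.
have L := ln_ge_half R n2; set Ln : R := ln n%:R in L *.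
have CL0 : 0 < (6 + A / rho) * Ln by rewrite mulr_gt0 //; lra.
rewrite -lee_pdivrMl //; apply: le_ereal_inf_tmp => _ [m /= mEI <-].
rewrite lee_pdivrMl //.
have -> : quadratic_risk P s (fun w => s_hat (EI_space R m) (obs_matrix X w)) =
    (bias s m + sample_mean s (block_chaos s (finset.pblock m)))%:E.
  rewrite -(sample_mean_cst s_sum (bias s m)) -sample_meanD.
  rewrite -(expectation_sample XP WP) => [|o]; last first.
    by rewrite addr_ge0 // frob_ge0.
  by congr expectation; apply/funext => w; rewrite WP projection_loss.
have pen0 : 0 <= EI_pen c1 c2 m.
  have := entropy_le_pen n0 hc1 hc2 mEI; apply: le_trans.
  by rewrite mulr_ge0 // entropy_ge0 ?EI_card_gt0 ?EI_card_le.
have dev0 (o : sample r n) : 0 <= max_deviation s o.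
  by apply: sumr_ge0 => B _; exact: expR_ge0.
pose G (o : sample r n) := 3 * bias s m + 4 * EI_pen c1 c2 m +
  256 * max_deviation s o.
have b0 : 0 <= bias s m by exact: frob_ge0.
have G0 o : 0 <= G o by rewrite /G; have := dev0 o; lra.
apply: (@le_trans _ _ ('E_P[fun w => G (W w)])%E).
  apply: ge0_expectation_le => w; first exact: sqr_ge0.
  rewrite WP; apply: penalized_loss => //.
  by have := m_hatP w; rewrite WP.
rewrite (expectation_sample XP WP) // -EFinM lee_fin /G.
rewrite sample_meanD sample_mean_cst // sample_meanZ.
have dev := max_deviation_mean s_ge0 s_sum n0.
have var := block_chaos_mean_ge s_ge0 s_sum (finset.pblock m) sle.
rewrite nblocks_pblock // in var.
have pen : EI_pen c1 c2 m <= #|m|%:R * (Ln * (c1 + 2 * c2)).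
  by apply: EI_pen_le => //; lra.
apply: (@oracle_constant _ c1 c2 rho Ln #|m|%:R) => //; try lra.
by rewrite ler1n EI_card_gt0.
Qed.
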